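(* Let $(X,\eta)$ be a $UCW$-hyperbolic space, $C\subseteq X$ a nonempty convex subset, and $T,U:C\to C$ nonexpansive mappings with $Fix(T)\cap Fix(U)\neq\emptyset$. Let $x_0,u\in C$, let $(\alpha_n)_{n\in\mathbb N},(\beta_n)_{n\in\mathbb N}$ be sequences in $[0,1]$, and let $(x_n),(y_n)$ be the alternating Halpern-Mann iteration: for all $n\in\mathbb N$, $y_n=(1-\alpha_n)Tx_n+\alpha_n u$ and $x_{n+1}=(1-\beta_n)Uy_n+\beta_n y_n$. Let $p\in Fix(T)\cap Fix(U)$, $M_p=\max\{d(x_0,p),d(u,p)\}$, and let $K\in\mathbb N$, $K\geq1$, satisfy $K\geq M_p$. Assume that - $\lim_{n\to\infty}\alpha_n=0$ with rate of convergence $\sigma_1:\mathbb N\to\mathbb N$; - $\sum_{n=0}^\infty\alpha_n$ diverges with rate of divergence $\sigma_2:\mathbb N\to\mathbb N$; - $\sum_{n=0}^\infty|\alpha_{n+1}-\alpha_n|$ converges with Cauchy modulus $\sigma_3:\mathbb N\to\mathbb N$; - $\sum_{n=0}^\infty|\beta_{n+1}-\beta_n|$ converges with Cauchy modulus $\sigma_4:\mathbb N\to\mathbb N$; - $\Lambda\in\mathbb N$ satisfies $\Lambda\geq2$ and $\frac1\Lambda\le\beta_n\le1-\frac1\Lambda$ for all $n\in\mathbb N$. Define $$\chi(k)=\max\{\sigma_3(4K(k+1)-1),\sigma_4(4K(k+1)-1)\},\qquad \Gamma_1(k)=\sigma_2\big(\chi(2k+1)+2+\lceil\ln(4K(k+1))\rceil\big)+1,$$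 $$\Gamma_3(k)=\max\{\Gamma_1(2P(k+1)-1),\ \sigma_1(2PK(k+1)-1)\},\quad\text{where } P=\left\lceil\frac{\Lambda^2}{\eta\left(K,\frac1{K(k+1)}\right)}\right\rceil,$$ $$\Omega(k)=\max\{\Gamma_1(2k+1),\Gamma_3(2k+1)\},\qquad\Gamma_4(k)=\max\{\Omega(2k+1),\sigma_1(4K(k+1)-1)\},$$ $$\Gamma_5(k)=\max\{\Omega(4k+3),\Gamma_3(2k+1)\},\qquad\Gamma_6(k)=\max\{\Omega(4k+3),\Gamma_4(2k+1)\}.$$ Then $(y_n)$ is $U$-asymptotically regular with rate $\Gamma_3$ and $T$-asymptotically regular with rate $\Gamma_4$, and $(x_n)$ is $U$-asymptotically regular with rate $\Gamma_5$ and $T$-asymptotically regular with rate $\Gamma_6$.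
   Context: $\mathbb N=\{0,1,2,\dots\}$. A $W$-hyperbolic space is a metric space $(X,d)$ with a function $W:X\times X\times[0,1]\to X$, where $(1-\lambda)x+\lambda y$ denotes $W(x,y,\lambda)$, such that for all $x,y,w,z\in X$ and $\lambda,\tilde\lambda\in[0,1]$: (W1) $d(z,(1-\lambda)x+\lambda y)\le(1-\lambda)d(z,x)+\lambda d(z,y)$; (W2) $d((1-\lambda)x+\lambda y,(1-\tilde\lambda)x+\tilde\lambda y)=|\lambda-\tilde\lambda|d(x,y)$; (W3) $(1-\lambda)x+\lambda y=\lambda y+(1-\lambda)x$, i.e. $W(x,y,\lambda)=W(y,x,1-\lambda)$; (W4) $d((1-\lambda)x+\lambda z,(1-\lambda)y+\lambda w)\le(1-\lambda)d(x,y)+\lambda d(z,w)$. A $UCW$-hyperbolic space is a pair $(X,\eta)$ where $X$ is a $W$-hyperbolic space and $\eta:(0,\infty)\times(0,2]\to(0,1]$ (a monotone modulus of uniform convexity) satisfies: (a) for all $r>0$, $\varepsilon\in(0,2]$ and $x,y,a\in X$, if $d(x,a)\le r$, $d(y,a)\le r$ and $d(x,y)\ge\varepsilon r$, then $d\left(\frac12x+\frac12y,a\right)\le(1-\eta(r,\varepsilon))r$; (b) for every $\varepsilon\in(0,2]$, if $0<r\le s$ then $\eta(s,\varepsilon)\le\eta(r,\varepsilon)$. A nonempty $C\subseteq X$ is convex if $(1-\lambda)x+\lambda y\in C$ for all $x,y\in C$, $\lambda\in[0,1]$. A mapping $S:C\to C$ is nonexpansive if $d(Sx,Sy)\le d(x,y)$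 for all $x,y\in C$; $Fix(S)$ is its set of fixed points. $\varphi:\mathbb N\to\mathbb N$ is a rate of convergence of a real sequence $(a_n)$ towards $0$ if $|a_n|\le\frac1{k+1}$ for all $k\in\mathbb N$ and all $n\ge\varphi(k)$. $\varphi$ is a Cauchy modulus of a real sequence $(a_n)$ if for all $k$, all $n\ge\varphi(k)$ and all $q\in\mathbb N$, $|a_{n+q}-a_n|\le\frac1{k+1}$; a Cauchy modulus of a series is a Cauchy modulus of its sequence $\left(\sum_{i=0}^n b_i\right)_n$ of partial sums. A series $\sum b_n$ of nonnegative reals diverges with rate of divergence $\theta:\mathbb N\to\mathbb N$ if $\sum_{i=0}^{\theta(n)}b_i\ge n$ for all $n\in\mathbb N$. For $S:C\to C$ and $(z_n)$ in $C$, $(z_n)$ is $S$-asymptotically regular with rate $\varphi$ if $\varphi$ is a rate of convergence of $(d(z_n,Sz_n))$ towards $0$. *)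

(* Defs.v *)
From mathcomp Require Import all_boot all_order all_algebra.
From mathcomp Require Import all_classical all_reals all_analysis.

Set Implicit Arguments.
Unset Strict Implicit.
Unset Printing Implicit Defensive.

Import Order.TTheory GRing.Theory Num.Theory.

Local Open Scope classical_set_scope.
Local Open Scope ring_scope.

(* [W x y l] is the point (1 - l) x + l y.  It is a total function of l : R, of
   which only the values at l in [0, 1] are constrained (and used). *)
Record W_hyperbolic (R : realType) (X : metricType R) (W : X -> X -> R -> X)
    : Prop := {
  W1 : forall (x y z : X) (l : R), 0 <= l <= 1 ->
    mdist z (W x y l) <= (1 - l) * mdist z x + l * mdist z y ;
  W2 : forall (x y : X) (l l' : R), 0 <= l <= 1 -> 0 <= l' <= 1 ->
    mdist (W x y l) (W x y l') = `|l - l'| * mdist x y ;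
  W3 : forall (x y : X) (l : R), 0 <= l <= 1 -> W x y l = W y x (1 - l) ;
  W4 : forall (x y z w : X) (l : R), 0 <= l <= 1 ->
    mdist (W x z l) (W y w l) <= (1 - l) * mdist x y + l * mdist z w }.

(* [eta] is likewise total on R x R; it is only constrained on its domain
   (0, oo) x (0, 2], where its values lie in (0, 1]. *)
Record UCW_hyperbolic (R : realType) (X : metricType R) (W : X -> X -> R -> X)
    (eta : R -> R -> R) : Prop := {
  UCW_W_hyperbolic : W_hyperbolic W ;
  eta_range : forall r e : R, 0 < r -> 0 < e <= 2 -> 0 < eta r e <= 1 ;
  eta_convexity : forall (r e : R) (x y a : X), 0 < r -> 0 < e <= 2 ->
    mdist x a <= r -> mdist y a <= r -> e * r <= mdist x y ->
    mdist (W x y (1 / 2)) a <= (1 - eta r e) * r ;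
  eta_monotone : forall r s e : R, 0 < e <= 2 -> 0 < r -> r <= s ->
    eta s e <= eta r e }.

Definition W_convex (R : realType) (X : metricType R) (W : X -> X -> R -> X)
    (C : set X) : Prop :=
  forall (x y : X) (l : R), C x -> C y -> 0 <= l <= 1 -> C (W x y l).

(* A self-map of C is represented by S : X -> X with [set_fun C C S]; its values
   outside C are irrelevant. *)
Definition nonexpansive (R : realType) (X : metricType R) (C : set X)
    (S : X -> X) : Prop :=
  forall x y : X, C x -> C y -> mdist (S x) (S y) <= mdist x y.

Definition Fix (X : Type) (C : set X) (S : X -> X) : set X :=
  [set x | C x /\ S x = x].

Definition rate_of_convergence0 (R : realType) (a : nat -> R)
    (phi : nat -> nat) : Prop :=
  forall k n : nat, (phi k <= n)%N -> `|a n| <= 1 / k.+1%:R.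

Definition Cauchy_modulus (R : realType) (a : nat -> R)
    (phi : nat -> nat) : Prop :=
  forall k n q : nat, (phi k <= n)%N -> `|a (n + q)%N - a n| <= 1 / k.+1%:R.

(* [series b n] has the terms of index i < n, hence the shift: the n-th partial
   sum is here b 0 + ... + b n. *)
Definition partial_sum (R : realType) (b : nat -> R) (n : nat) : R :=
  series b n.+1.

Definition series_Cauchy_modulus (R : realType) (b : nat -> R)
    (phi : nat -> nat) : Prop :=
  Cauchy_modulus (partial_sum b) phi.

Definition rate_of_divergence (R : realType) (b : nat -> R)
    (theta : nat -> nat) : Prop :=
  forall n : nat, n%:R <= partial_sum b (theta n).

Definition asymptotically_regular (R : realType) (X : metricType R)
    (S : X -> X) (z : nat -> X) (phi : nat -> nat) : Prop :=
  rate_of_convergence0 (fun n => mdist (z n) (S (z n))) phi.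

(* The ceiling as a natural number; it is only meant for r > -1, where the
   integer [Num.ceil r] is nonnegative. *)
Definition ceiln (R : realType) (r : R) : nat := `|Num.ceil r|%N.

(* Main.v *)
(** Write s_n = d(x_n, x_{n+1}).  Nonexpansiveness and (W2), (W4) give the
    recursion s_{n+1} <= (1 - alpha_{n+1}) s_n + 2K (|alpha_{n+1} - alpha_n| +
    |beta_{n+1} - beta_n|), so s_n -> 0 with rate [Gamma1], because the product
    of the 1 - alpha_i is at most exp (- sum alpha_i).  If d(y_n, U y_n) were
    larger than 1/(k+1), uniform convexity would make d(x_{n+1}, p) smaller than
    d(x_n, p) by more than s_n allows; this bounds d(y_n, U y_n), and the other
    three rates follow by the triangle inequality. *)
Require Import Defs.
From mathcomp Require Import all_boot all_order all_algebra.
From mathcomp Require Import all_classical all_reals all_analysis.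
From mathcomp Require Import ring lra zify.

Set Implicit Arguments.
Unset Strict Implicit.
Unset Printing Implicit Defensive.

Import Order.TTheory GRing.Theory Num.Theory.

Local Open Scope classical_set_scope.
Local Open Scope ring_scope.

(** * Ceilings, rates and partial sums *)

Lemma ceiln_ge (R : realType) (r : R) : r <= (ceiln r)%:R.
Proof.
by rewrite /ceiln natr_absz (le_trans (Num.Theory.ceil_ge _))// ler_int ler_norm.
Qed.

(** Rates are evaluated below at indices [m - 1], so that [k.+1] in the definition becomes [m];
    [0 < m] makes the truncated subtraction exact. *)
Lemma rate_of_convergence0_pred (R : realType) (a : nat -> R) phi (m n : nat) :
  rate_of_convergence0 a phi -> (0 < m)%N -> (phi (m - 1) <= n)%N ->
  `|a n| <= 1 / m%:R.
Proof. by move=> ha m0 /ha; rewrite subn1 prednK. Qed.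

Lemma Cauchy_modulus_pred (R : realType) (a : nat -> R) phi (m n q : nat) :
  Cauchy_modulus a phi -> (0 < m)%N -> (phi (m - 1) <= n)%N ->
  a (n + q)%N - a n <= 1 / m%:R.
Proof.
move=> ha m0 hn; have := ha _ _ q hn; rewrite subn1 prednK//.
by apply: le_trans; exact: ler_norm.
Qed.

Lemma series_unit_le (R : realType) (a : nat -> R) (n : nat) :
  (forall i, 0 <= a i <= 1) -> series a n <= n%:R.
Proof.
move=> ha; elim: n => [|n IH]; first by rewrite /series/= big_geq.
by rewrite seriesSr -natr1 lerD//; case/andP: (ha n).
Qed.

Lemma series_nneg_le (R : realType) (a : nat -> R) (m n : nat) :
  (forall i, 0 <= a i) -> (m <= n)%N -> series a m <= series a n.
Proof.
move=> ha; elim: n => [|n IH]; first by rewrite leqn0 => /eqP ->.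
rewrite leq_eqVlt => /predU1P[->//|/IH le_mn].
by rewrite seriesSr (le_trans le_mn)// lerDl.
Qed.

(** * Recursive inequalities *)

(** Each step multiplies by [1 - a n.+1], which is at most [expR (- a n.+1)]; as this factor is also
    at most 1, the errors collected so far do not grow. The exponent runs over the indices N+1 to
    N+m, the errors over N to N+m-1. *)
Lemma recursion_exp_bound (R : realType) (s a c : nat -> R) (N : nat) :
  (forall n, 0 <= s n) -> (forall n, 0 <= a n <= 1) -> (forall n, 0 <= c n) ->
  (forall n, s n.+1 <= (1 - a n.+1) * s n + c n) ->
  forall m, s (N + m)%N <=
    expR (- (partial_sum a (N + m)%N - partial_sum a N)) * s N +
    (series c (N + m)%N - series c N).
Proof.
move=> hs ha hc hrec; elim=> [|m IH].
  by rewrite addn0 !subrr oppr0 expR0 mul1r addr0.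
rewrite addnS; apply: le_trans (hrec _) _.
have /andP[a0 a1] := ha (N + m)%N.+1.
rewrite /partial_sum [series a (N + m)%N.+2]seriesSr [series c _.+1]seriesSr.
move: IH; rewrite /partial_sum; set A := _ - series a _; set D := _ - series c N => IH.
have D0 : 0 <= D by rewrite subr_ge0 series_nneg_le// leq_addr.
have -> : - (series a (N + m)%N.+1 + a (N + m)%N.+1 - series a N.+1) =
    - A + - a (N + m)%N.+1 by rewrite /A; ring.
rewrite expRD.
have he := expR_ge1Dx (- a (N + m)%N.+1).
have E0 := expR_ge0 (- A).
set e := expR (- a _) in he *; set E := expR (- A) in IH E0 *.
apply: (@le_trans _ _ ((1 - a (N + m)%N.+1) * (E * s N + D) + c (N + m)%N)).
  by rewrite lerD2r ler_wpM2l// subr_ge0.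
rewrite (_ : series c (N + m)%N + _ - _ = D + c (N + m)%N); last first.
  by rewrite /D; ring.
rewrite [leRHS]addrA lerD2r mulrDr lerD//; last by rewrite ler_piMl// gerBl.
by rewrite mulrA [_ * E]mulrC ler_wpM2r// ler_wpM2l.
Qed.

(** The exponential bound is started at [N.+1], where [N] is the larger of the two Cauchy moduli at
    [m]. The [a i] with [i <= N.+1] sum to at most [N + 2], so a partial sum of at least [N + 2 + L]
    leaves at least [L] in the exponent. The exponential term and the error term each receive half
    of [1 / k.+1%:R]. *)
Lemma recursion_rate (R : realType) (s a b b' : nat -> R) (K : nat)
    (theta sg sg' : nat -> nat) (k n : nat) :
  (0 < K)%N -> (forall n, 0 <= s n <= 2 * K%:R) ->
  (forall n, 0 <= a n <= 1) -> (forall n, 0 <= b n) -> (forall n, 0 <= b' n) ->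
  (forall n, s n.+1 <= (1 - a n.+1) * s n + 2 * K%:R * (b n + b' n)) ->
  rate_of_divergence a theta ->
  series_Cauchy_modulus b sg -> series_Cauchy_modulus b' sg' ->
  let m := (4 * K * (2 * k + 1 + 1) - 1)%N in
  (theta (maxn (sg m) (sg' m) + 2 + ceiln (ln ((4 * K * (k + 1))%:R : R))) + 1
     <= n)%N ->
  s n <= 1 / k.+1%:R.
Proof.
move=> K0 hs ha hb hb' hrec htheta hsg hsg' m.
set N := maxn _ _; set L := ceiln _ => hn.
set c := fun n => 2 * K%:R * (b n + b' n).
have series_c i : series c i = 2 * K%:R * (series b i + series b' i).
  elim: i => [|i IH]; first by rewrite /series/= !big_geq// addr0 mulr0.
  by rewrite !seriesSr IH /c; ring.
have K0R : 0 < K%:R :> R by rewrite ltr0n.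
have k0R : 0 < k.+1%:R :> R by [].
have hA : (N + 2 + L)%:R <= partial_sum a n.
  apply: le_trans (htheta _) _; apply: series_nneg_le.
    by move=> i; case/andP: (ha i).
  by rewrite ltnS; lia.
(* As a_i <= 1, the divergence rate satisfies theta(j) + 1 >= j. *)
have le_Nn : (N.+1 <= n)%N.
  have := le_trans hA (series_unit_le n.+1 ha).
  by rewrite ler_nat; lia.
have hAN : partial_sum a N.+1 <= (N + 2)%:R.
  by rewrite addn2; exact: series_unit_le.
have c0 i : 0 <= c i by rewrite mulr_ge0 ?addr_ge0// mulr_ge0.
have s0 i : 0 <= s i by case/andP: (hs i).
have := recursion_exp_bound N.+1 s0 ha c0 hrec (n - N.+1)%N.
rewrite subnKC// => /le_trans; apply.
have -> : 1 / k.+1%:R = 1 / (2 * k.+1%:R) + 1 / (2 * k.+1%:R) :> R by field; lra.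
apply: lerD.
  have L4 : (4 * K * (k + 1))%:R = 4 * K%:R * k.+1%:R :> R.
    by rewrite -addn1; ring.
  have L0 : 0 < (4 * K * (k + 1))%:R :> R by rewrite L4 !mulr_gt0.
  (* The factor [2 * K%:R] bounds the starting value [s N.+1]; dividing it by 4K(k+1) gives exactly
     1/(2(k+1)). *)
  apply: (@le_trans _ _ (expR (- ln ((4 * K * (k + 1))%:R : R)) * (2 * K%:R))).
    apply: ler_pM => //; last by case/andP: (hs N.+1).
    rewrite ler_expR lerN2.
    have := ceiln_ge (ln ((4 * K * (k + 1))%:R : R)).
    rewrite -/L; move: hA; rewrite natrD; lra.
  rewrite expRN lnK ?posrE// L4 le_eqVlt; apply/orP; left; apply/eqP.
  by field; lra.
rewrite !series_c -mulrBr.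
have m0 : (0 < 4 * K * (2 * k + 1 + 1))%N by lia.
have hb1 := Cauchy_modulus_pred (n - N.+1) hsg m0 (leq_maxl _ _ : (_ <= N)%N).
have hb2 := Cauchy_modulus_pred (n - N.+1) hsg' m0 (leq_maxr _ _ : (_ <= N)%N).
(* Starting at [N.+1] absorbs the shift between [series] and [partial_sum]: the increment of
   [series] from [N.+1] to [n] is that of [partial_sum] from [N] to [n - 1]. *)
move: hb1 hb2; rewrite /partial_sum -!addSn subnKC//.
set S := 1 / _ => hb1 hb2.
have -> : 1 / (2 * k.+1%:R) = 2 * K%:R * (S + S).
  by rewrite /S -[k.+1]addn1; field; have := ler0n R k; lra.
by rewrite ler_pM2l ?mulr_gt0//; lra.
Qed.

(** * Convexity estimates in hyperbolic spaces *)

Lemma W_dist_left (R : realType) (X : metricType R) (W : X -> X -> R -> X)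
    (x y : X) (l : R) : W_hyperbolic W -> 0 <= l <= 1 ->
  mdist x (W x y l) <= l * mdist x y.
Proof. by move=> hW /(W1 hW x y x); rewrite mdistxx mulr0 add0r. Qed.

Lemma W_dist_right (R : realType) (X : metricType R) (W : X -> X -> R -> X)
    (x y : X) (l : R) : W_hyperbolic W -> 0 <= l <= 1 ->
  mdist y (W x y l) <= (1 - l) * mdist x y.
Proof.
by move=> hW /(W1 hW x y y); rewrite mdistxx mulr0 addr0 (metric_sym y x).
Qed.

(** Via [W y w l]: (W4) moves the endpoints, (W2) the parameter. *)
Lemma W_dist_le (R : realType) (X : metricType R) (W : X -> X -> R -> X)
    (x y z w : X) (l l' : R) : W_hyperbolic W -> 0 <= l <= 1 -> 0 <= l' <= 1 ->
  mdist (W x z l) (W y w l') <=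
    (1 - l) * mdist x y + l * mdist z w + `|l - l'| * mdist y w.
Proof.
move=> hW hl hl'; apply: le_trans (metric_triangle _ (W y w l) _) _.
by rewrite lerD ?(W4 hW)// (W2 hW).
Qed.

(* If z1 <> z2, the midpoint of z1 and z2 is strictly closer to x than
   l * d(x, y), which breaks the triangle inequality between x and y. *)
Lemma between_unique (R : realType) (X : metricType R) (W : X -> X -> R -> X)
    (eta : R -> R -> R) (x y z1 z2 : X) (l : R) : UCW_hyperbolic W eta ->
  mdist x z1 <= l * mdist x y -> mdist y z1 <= (1 - l) * mdist x y ->
  mdist x z2 <= l * mdist x y -> mdist y z2 <= (1 - l) * mdist x y ->
  z1 = z2.
Proof.
move=> hX; set D := mdist x y => hx1 hy1 hx2 hy2.
apply/eqP/negP => /negP; rewrite -mdist_gt0 => z12.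
have h12 : mdist z1 z2 <= 2 * (l * D).
  by have := metric_triangle z1 x z2; rewrite (metric_sym z1 x); lra.
have r0 : 0 < l * D by lra.
(* With this ratio the separation [e * r] is exactly [mdist z1 z2]. *)
have e02 : 0 < mdist z1 z2 / (l * D) <= 2.
  by rewrite divr_gt0//= ler_pdivrMr.
have /andP[eta0 _] := eta_range hX r0 e02.
have := eta_convexity hX (x := z1) (y := z2) (a := x) r0 e02.
rewrite divfK ?gt_eqF// !(metric_sym _ x) => /(_ hx1 hx2 (lexx _)).
have half : 0 <= (1 / 2 : R) <= 1 by lra.
have := W1 (UCW_W_hyperbolic hX) z1 z2 y half.
have := metric_triangle x (W z1 z2 (1 / 2)) y; rewrite -/D (metric_sym _ y).
have := mulr_gt0 eta0 r0; rewrite mulrBl mul1r; lra.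
Qed.

(** Both points meet the bounds of [between_unique], hence coincide. This reduces a general
    parameter to the midpoint, the only case covered by [eta]. *)
Lemma W_half (R : realType) (X : metricType R) (W : X -> X -> R -> X)
    (eta : R -> R -> R) (x y : X) (l : R) : UCW_hyperbolic W eta ->
  0 <= l <= 1 / 2 -> W x y l = W x (W x y (1 / 2)) (2 * l).
Proof.
move=> hX hl; have hW := UCW_W_hyperbolic hX.
have hl1 : 0 <= l <= 1 by lra.
have h2l : 0 <= 2 * l <= 1 by lra.
have half : 0 <= (1 / 2 : R) <= 1 by lra.
apply: (between_unique (x := x) (y := y) (l := l) hX).
- exact: W_dist_left.
- exact: W_dist_right.
- apply: le_trans (W_dist_left _ _ hW h2l) _.
  apply: le_trans (ler_wpM2l _ (W_dist_left _ _ hW half)) _; first lra.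
  by rewrite le_eqVlt; apply/orP; left; apply/eqP; field.
- apply: le_trans (W1 hW _ _ y h2l) _; rewrite (metric_sym y x).
  apply: le_trans (lerD (lexx _) (ler_wpM2l _ (W_dist_right _ _ hW half))) _.
    lra.
  by rewrite le_eqVlt; apply/orP; left; apply/eqP; field.
Qed.

(** By (W3) one may take [l <= 1 / 2]. Convexity between [x] and the midpoint then gives the factor
    [1 - 2 * l * eta s e], which is even smaller than claimed; the claimed form is symmetric in [l]
    and [1 - l]. Monotonicity of [eta] allows a fixed [s] for varying radii [r]. *)
Lemma eta_convexity_W (R : realType) (X : metricType R) (W : X -> X -> R -> X)
    (eta : R -> R -> R) (r s e l : R) (x y a : X) : UCW_hyperbolic W eta ->
  0 < r -> r <= s -> 0 < e <= 2 -> 0 <= l <= 1 ->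
  mdist x a <= r -> mdist y a <= r -> e * r <= mdist x y ->
  mdist (W x y l) a <= (1 - 2 * l * (1 - l) * eta s e) * r.
Proof.
move=> hX r0 rs he.
wlog l_half : x y l / l <= 1 / 2 => [hwlog hl hx hy hxy|hl hx hy hxy].
  have [l_half|l_half] := leP l (1 / 2); first exact: hwlog.
  rewrite (W3 (UCW_W_hyperbolic hX))//.
  have -> : 2 * l * (1 - l) = 2 * (1 - l) * (1 - (1 - l)) by ring.
  by apply: hwlog => //; [lra | lra | rewrite metric_sym].
have l2 : 0 <= l <= 1 / 2 by rewrite l_half andbT; case/andP: hl.
rewrite (W_half _ _ hX)// metric_sym.
have h2l : 0 <= 2 * l <= 1 by lra.
apply: le_trans (W1 (UCW_W_hyperbolic hX) _ _ _ h2l) _.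
rewrite !(metric_sym a).
have hm := eta_convexity hX r0 he hx hy hxy.
have hmon := eta_monotone hX he r0 rs.
have s0 := lt_le_trans r0 rs.
have /andP[eta0 _] := eta_range hX s0 he.
have hm' : mdist (W x y (1 / 2)) a <= (1 - eta s e) * r.
  by apply: le_trans hm _; rewrite ler_pM2r// lerD2l lerN2.
apply: (@le_trans _ _ ((1 - 2 * l) * r + 2 * l * ((1 - eta s e) * r))).
  by apply: lerD; apply: ler_wpM2l => //; lra.
rewrite -subr_ge0 (_ : _ - _ = 2 * l ^+ 2 * (eta s e * r)); last by ring.
apply: mulr_ge0; last by rewrite ltW// mulr_gt0.
by apply: mulr_ge0 => //; exact: sqr_ge0.
Qed.

Theorem corollary3p6 (R : realType) (X : metricType R) (W : X -> X -> R -> X)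
    (eta : R -> R -> R) (hX : UCW_hyperbolic W eta)
    (C : set X) (hC0 : C !=set0) (hC : W_convex W C)
    (T U : X -> X) (hTC : set_fun C C T) (hUC : set_fun C C U)
    (hT : nonexpansive C T) (hU : nonexpansive C U)
    (hTU : Fix C T `&` Fix C U !=set0)
    (x0 u : X) (hx0 : C x0) (hu : C u)
    (alpha beta : nat -> R)
    (halpha : forall n, 0 <= alpha n <= 1) (hbeta : forall n, 0 <= beta n <= 1)
    (x y : nat -> X) (hx_0 : x 0%N = x0)
    (hy : forall n, y n = W (T (x n)) u (alpha n))
    (hx : forall n, x n.+1 = W (U (y n)) (y n) (beta n))
    (p : X) (hp : (Fix C T `&` Fix C U) p)
    (K : nat) (hK1 : (1 <= K)%N)
    (hK : Num.max (mdist x0 p) (mdist u p) <= K%:R)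
    (sigma1 sigma2 sigma3 sigma4 : nat -> nat)
    (hsigma1 : rate_of_convergence0 alpha sigma1)
    (hsigma2 : rate_of_divergence alpha sigma2)
    (hsigma3 :
      series_Cauchy_modulus (fun n => `|alpha n.+1 - alpha n|) sigma3)
    (hsigma4 :
      series_Cauchy_modulus (fun n => `|beta n.+1 - beta n|) sigma4)
    (Lambda : nat) (hLambda2 : (2 <= Lambda)%N)
    (hLambda : forall n, 1 / Lambda%:R <= beta n <= 1 - 1 / Lambda%:R) :
  let chi (k : nat) : nat :=
    maxn (sigma3 (4 * K * (k + 1) - 1)%N) (sigma4 (4 * K * (k + 1) - 1)%N) in
  let Gamma1 (k : nat) : nat :=
    (sigma2 (chi (2 * k + 1) + 2
             + ceiln (ln ((4 * K * (k + 1))%:R : R))) + 1)%N in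
  let P (k : nat) : nat :=
    ceiln (Lambda%:R ^+ 2 / eta K%:R (1 / (K * (k + 1))%:R)) in
  let Gamma3 (k : nat) : nat :=
    maxn (Gamma1 (2 * P k * (k + 1) - 1)%N)
         (sigma1 (2 * P k * K * (k + 1) - 1)%N) in
  let Omega (k : nat) : nat :=
    maxn (Gamma1 (2 * k + 1)%N) (Gamma3 (2 * k + 1)%N) in
  let Gamma4 (k : nat) : nat :=
    maxn (Omega (2 * k + 1)%N) (sigma1 (4 * K * (k + 1) - 1)%N) in
  let Gamma5 (k : nat) : nat :=
    maxn (Omega (4 * k + 3)%N) (Gamma3 (2 * k + 1)%N) in
  let Gamma6 (k : nat) : nat :=
    maxn (Omega (4 * k + 3)%N) (Gamma4 (2 * k + 1)%N) in
  [/\ asymptotically_regular U y Gamma3,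
      asymptotically_regular T y Gamma4,
      asymptotically_regular U x Gamma5 &
      asymptotically_regular T x Gamma6].
Proof.
move=> chi Gamma1 P Gamma3 Omega Gamma4 Gamma5 Gamma6.

(* Rates for the alternating Halpern-Mann iteration *)
have hW := UCW_W_hyperbolic hX.
have [[Cp Tp] [_ Up]] := hp.
have K0 : 0 < K%:R :> R by rewrite ltr0n.
have a0 n : 0 <= alpha n by case/andP: (halpha n).
have a1 n : 0 <= 1 - alpha n by rewrite subr_ge0; case/andP: (halpha n).
have b0 n : 0 <= beta n by case/andP: (hbeta n).
have b1 n : 0 <= 1 - beta n by rewrite subr_ge0; case/andP: (hbeta n).
have [dx0 du] : mdist x0 p <= K%:R /\ mdist u p <= K%:R.
  by apply/andP; rewrite -ge_max.
have Cy n : C (x n) -> C (y n).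
  by move=> Cx; rewrite hy; apply: hC => //; exact: hTC.
have Cx n : C (x n).
  elim: n => [|n IH]; first by rewrite hx_0.
  by rewrite hx; apply: hC => //; [apply: hUC|]; exact: Cy.
have {}Cy n : C (y n) by exact: Cy.
have dT z : C z -> mdist (T z) p <= mdist z p.
  by move=> Cz; have := hT _ _ Cz Cp; rewrite Tp.
have dU z : C z -> mdist (U z) p <= mdist z p.
  by move=> Cz; have := hU _ _ Cz Cp; rewrite Up.
(* Kept sharper than a bound by [K]: it shows that passing from [x n] to [y n] raises the distance
   to [p] by at most [alpha n * mdist u p]. *)
have dy_step n :
    mdist (y n) p <= (1 - alpha n) * mdist (x n) p + alpha n * mdist u p.
  rewrite hy metric_sym; apply: le_trans (W1 hW _ _ _ (halpha n)) _.
  by rewrite !(metric_sym p) lerD2r ler_wpM2l ?dT.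
have dx_step n : mdist (x n.+1) p <= mdist (y n) p.
  rewrite hx metric_sym; apply: le_trans (W1 hW _ _ _ (hbeta n)) _.
  rewrite !(metric_sym p).
  by have := ler_wpM2l (b1 n) (dU _ (Cy n)); lra.
have dy_of_dx n : mdist (x n) p <= K%:R -> mdist (y n) p <= K%:R.
  move=> hn; apply: le_trans (dy_step n) _.
  by have := ler_wpM2l (a1 n) hn; have := ler_wpM2l (a0 n) du; lra.
have dx n : mdist (x n) p <= K%:R.
  elim: n => [|n IH]; first by rewrite hx_0.
  exact: le_trans (dx_step n) (dy_of_dx _ IH).
have dy n : mdist (y n) p <= K%:R by exact: dy_of_dx.
have dist2K z w : mdist z p <= K%:R -> mdist w p <= K%:R ->
    mdist z w <= 2 * K%:R.
  by move=> hz hw; have := metric_triangle z p w; rewrite (metric_sym p); lra.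
(* The anchor [u] is common to [y n] and [y n.+1], so only the change of [alpha] is added; for [x],
   nonexpansiveness of [U] merges the two weighted terms. *)
have s_rec n : mdist (x n.+1) (x n.+2) <= (1 - alpha n.+1) * mdist (x n) (x n.+1)
    + 2 * K%:R * (`|alpha n.+1 - alpha n| + `|beta n.+1 - beta n|).
  have step_y : mdist (y n.+1) (y n) <= (1 - alpha n.+1) * mdist (x n) (x n.+1)
      + `|alpha n.+1 - alpha n| * (2 * K%:R).
    rewrite !hy; apply: le_trans (W_dist_le _ _ _ _ hW _ _) _ => //.
    rewrite mdistxx mulr0 addr0 (metric_sym (x n)) lerD// ler_wpM2l//.
    - exact: hT.
    - by apply: dist2K => //; exact: le_trans (dT _ _) _.
  have step_x : mdist (x n.+2) (x n.+1) <=
      mdist (y n.+1) (y n) + `|beta n.+1 - beta n| * (2 * K%:R).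
    rewrite !(hx _.+1) hx; apply: le_trans (W_dist_le _ _ _ _ hW _ _) _ => //.
    have := ler_wpM2l (b1 n.+1) (hU _ _ (Cy n.+1) (Cy n)).
    have dUy : mdist (U (y n)) (y n) <= 2 * K%:R.
      by apply: dist2K => //; exact: le_trans (dU _ _) _.
    by have := ler_wpM2l (normr_ge0 (beta n.+1 - beta n)) dUy; lra.
  by rewrite (metric_sym (x n.+1)); lra.
have s_rate k n : (Gamma1 k <= n)%N -> mdist (x n) (x n.+1) <= 1 / k.+1%:R.
  apply: (recursion_rate hK1 _ halpha _ _ s_rec hsigma2 hsigma3 hsigma4) => //.
  by move=> i; rewrite mdist_ge0 dist2K.
have alpha_rate m n : (0 < m)%N -> (sigma1 (m - 1) <= n)%N ->
    alpha n <= 1 / m%:R.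
  move=> m0 /(rate_of_convergence0_pred hsigma1 m0).
  by apply: le_trans; exact: ler_norm.
have Uy_rate k n : (Gamma3 k <= n)%N -> mdist (y n) (U (y n)) <= 1 / k.+1%:R.
  rewrite geq_max => /andP[hG ha].
  (* Chosen so that [e * K%:R] is [1 / k.+1%:R]: as [mdist (y n) p] is at most [K], a gap above
     [1 / k.+1%:R] is then a separation of at least [e] relative to that radius. *)
  set e : R := 1 / (K * (k + 1))%:R in P Gamma3 Omega Gamma4 Gamma5 Gamma6 hG ha *.
  have k0 : 0 < k.+1%:R :> R by [].
  have eK : e * K%:R = 1 / k.+1%:R by rewrite /e -[k.+1]addn1; field; have := ler0n R k; lra.
  have e02 : 0 < e <= 2.
    rewrite /e divr_gt0 ?ltr0n ?muln_gt0 ?hK1 ?addn1//=.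
    rewrite ler_pdivrMr ?ltr0n ?muln_gt0 ?hK1//.
    by rewrite -[X in X <= _]/(1%:R) -natrM ler_nat; lia.
  have /andP[eta0 _] := eta_range hX K0 e02.
  have L0 : 0 < Lambda%:R :> R by rewrite ltr0n; lia.
  have hP : Lambda%:R ^+ 2 / eta K%:R e <= (P k)%:R := ceiln_ge _.
  have P0 : 0 < (P k)%:R :> R.
    by apply: lt_le_trans hP; rewrite divr_gt0// exprn_gt0.
  have P0n : (0 < P k)%N by rewrite -(ltr0n R).
  have hs : mdist (x n) (x n.+1) <= 1 / (2 * P k * (k + 1))%:R.
    by have := s_rate _ _ hG; rewrite subn1 prednK// !muln_gt0 P0n addn1.
  have {}ha : alpha n <= 1 / (2 * P k * K * (k + 1))%:R.
    by apply: alpha_rate ha; rewrite !muln_gt0 P0n hK1 addn1.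
  rewrite leNgt; apply/negP => hlt.
  (* The gap is at most twice the radius, so the radius is bounded below; this makes the decrease in
     [drop] quantitative. *)
  have hr : 1 / k.+1%:R < 2 * mdist (y n) p.
    apply: lt_le_trans hlt _; apply: le_trans (metric_triangle _ p _) _.
    by rewrite (metric_sym p) mulr_natl mulr2n lerD2l dU.
  have r0 : 0 < mdist (y n) p.
    have k1 : 0 < 1 / k.+1%:R :> R by rewrite divr_gt0.
    by have := lt_trans k1 hr; rewrite pmulr_rgt0.
  have er : e * mdist (y n) p <= mdist (U (y n)) (y n).
    rewrite (metric_sym (U _)); apply: le_trans (ltW hlt); rewrite -eK.
    by apply: ler_wpM2l; [case/andP: e02 => /ltW | exact: dy].
  have hxp := eta_convexity_W hX r0 (dy n) e02 (hbeta n) (dU _ (Cy n))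
    (lexx _) er.
  rewrite -hx in hxp.
  (* [P k] dominates Lambda^2/eta, and both [beta n] and [1 - beta n] are at least 1/Lambda. *)
  have hLa : 1 / (P k)%:R <= beta n * (1 - beta n) * eta K%:R e.
    have L2 : 0 < Lambda%:R ^+ 2 :> R by rewrite exprn_gt0.
    apply: (@le_trans _ _ ((1 / Lambda%:R) * (1 / Lambda%:R) * eta K%:R e)).
      have -> : 1 / Lambda%:R * (1 / Lambda%:R) * eta K%:R e =
          eta K%:R e / Lambda%:R ^+ 2 by field; rewrite gt_eqF.
      by rewrite ler_pdivrMr// mulrAC ler_pdivlMr// mul1r mulrC -ler_pdivrMr.
    have /andP[hb1 hb2] := hLambda n.
    by rewrite ler_pM2r// ler_pM ?divr_ge0//; lra.
  have drop : 1 / (P k)%:R * (1 / k.+1%:R) <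
      2 * beta n * (1 - beta n) * eta K%:R e * mdist (y n) p.
    apply: (@lt_le_trans _ _ (1 / (P k)%:R * (2 * mdist (y n) p))).
      by rewrite ltr_pM2l// divr_gt0.
    by have := ler_wpM2r (ltW r0) hLa; lra.
  have aK : alpha n * mdist u p <= 1 / (P k)%:R * (1 / k.+1%:R) / 2.
    apply: (@le_trans _ _ (1 / (2 * P k * K * (k + 1))%:R * K%:R)).
      by apply: ler_pM => //; exact: mdist_ge0.
    rewrite le_eqVlt; apply/orP; left; apply/eqP.
    by rewrite -[k.+1]addn1; field; have := ler0n R k; lra.
  have s2 : mdist (x n) (x n.+1) <= 1 / (P k)%:R * (1 / k.+1%:R) / 2.
    apply: le_trans hs _; rewrite le_eqVlt; apply/orP; left; apply/eqP.
    by rewrite -[k.+1]addn1; field; have := ler0n R k; lra.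
  (* The contradiction: the decrease exceeds [q], while [aK] and [s2] allow the anchor and the step
     from [x n] to [x n.+1] to make up only [q / 2] each. *)
  have ax : 0 <= alpha n * mdist (x n) p.
    by rewrite mulr_ge0 ?mdist_ge0.
  have := metric_triangle (x n) (x n.+1) p.
  move: drop aK s2; set q := _ * (1 / _) => drop aK s2.
  by have := dy_step n; lra.
have half_rate k : 1 / (2 * k + 1).+1%:R = 1 / k.+1%:R / 2 :> R.
  rewrite (_ : (2 * k + 1).+1 = 2 * k.+1)%N; last by lia.
  by rewrite natrM; field; rewrite gt_eqF.
(* Passing through [x n.+1], which lies between [U (y n)] and [y n], costs half for each leg. *)
have xy_rate k n : (Omega k <= n)%N -> mdist (x n) (y n) <= 1 / k.+1%:R.
  rewrite geq_max => /andP[/s_rate + /Uy_rate]; rewrite half_rate.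
  set q := 1 / k.+1%:R => hs hUy.
  have := W_dist_right (U (y n)) (y n) hW (hbeta n); rewrite -hx => hyx.
  have := metric_triangle (x n) (x n.+1) (y n); rewrite (metric_sym (x n.+1)).
  have : (1 - beta n) * mdist (U (y n)) (y n) <= mdist (y n) (U (y n)).
    rewrite metric_sym.
    by have := mulr_ge0 (b0 n) (mdist_ge0 (y n) (U (y n))); lra.
  by lra.
(* Passing through [T (x n)]: one half comes from [alpha n] times the diameter bound 2K, the other
   from [mdist (x n) (y n)]. *)
have Ty_rate k n : (Gamma4 k <= n)%N -> mdist (y n) (T (y n)) <= 1 / k.+1%:R.
  rewrite geq_max => /andP[/xy_rate + ha]; rewrite half_rate.
  set q := 1 / k.+1%:R => hxy.
  have {}ha : alpha n <= 1 / (4 * K * (k + 1))%:R.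
    by apply: alpha_rate ha; rewrite !muln_gt0 hK1 addn1.
  have := W_dist_left (T (x n)) u hW (halpha n); rewrite -hy => hTy.
  have hTu : mdist (T (x n)) u <= 2 * K%:R.
    by apply: dist2K => //; exact: le_trans (dT _ _) _.
  have : alpha n * mdist (T (x n)) u <= q / 2.
    apply: (@le_trans _ _ (1 / (4 * K * (k + 1))%:R * (2 * K%:R))).
      by apply: ler_pM => //; exact: mdist_ge0.
    rewrite le_eqVlt; apply/orP; left; apply/eqP.
    by rewrite /q -[k.+1]addn1; field; have := ler0n R k; lra.
  have := metric_triangle (y n) (T (x n)) (T (y n)).
  rewrite (metric_sym (y n) (T (x n))).
  by have := hT _ _ (Cx n) (Cy n); lra.
have quarter_rate k : 1 / (4 * k + 3).+1%:R = 1 / k.+1%:R / 4 :> R.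
  rewrite (_ : (4 * k + 3).+1 = 4 * k.+1)%N; last by lia.
  by rewrite natrM; field; rewrite gt_eqF.
(* The distance from [x n] to [y n] enters twice, once through [S], hence a quarter for it and a
   half for the gap at [y n]. *)
have x_of_y S k n : nonexpansive C S -> (Omega (4 * k + 3) <= n)%N ->
    mdist (y n) (S (y n)) <= 1 / (2 * k + 1).+1%:R ->
    mdist (x n) (S (x n)) <= 1 / k.+1%:R.
  move=> hS /xy_rate; rewrite quarter_rate half_rate.
  set q := 1 / k.+1%:R => hxy hSy.
  have := hS _ _ (Cy n) (Cx n); rewrite (metric_sym (y n) (x n)).
  have := metric_triangle (x n) (y n) (S (x n)).
  have := metric_triangle (y n) (S (y n)) (S (x n)).
  by lra.
split=> k n hn; rewrite ger0_norm ?mdist_ge0//.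
- exact: Uy_rate.
- exact: Ty_rate.
- by move: hn; rewrite geq_max => /andP[hn /Uy_rate]; exact: x_of_y.
- by move: hn; rewrite geq_max => /andP[hn /Ty_rate]; exact: x_of_y.
Qed.
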